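(* Let $R\in S^2_B(\wedge^2\mathbb{R}^3)$ be an algebraic curvature operator on $\mathbb{R}^3$ and denote by $a\le b\le c$ the eigenvalues of the curvature operator (of the first kind) $\hat R$. Then the eigenvalues of the curvature operator of the second kind $\mathring R$ (five eigenvalues, listed with multiplicity) are given by $$\lambda_-\le a\le b\le c\le \lambda_+,$$ where $$\lambda_\pm := \frac{a+b+c}{3}\pm\frac{\sqrt2}{3}\sqrt{3(a^2+b^2+c^2)-(a+b+c)^2}.$$
   Context: $S^2_B(\wedge^2\mathbb{R}^3)$ is the space of algebraic curvature operators on the Euclidean space $\mathbb{R}^3$: tensors $R_{ijkl}$ with $R_{ijkl}=-R_{jikl}=-R_{ijlk}=R_{klij}$ satisfying the first Bianchi identity, where components are taken in an orthonormal basis. The sign convention is such that $R_{ijij}$ is the sectional curvature of the plane spanned by $e_i,e_j$ (so $R_{ijkl}=\delta_{ik}\delta_{jl}-\delta_{il}\delta_{jk}$ on the unit sphere). The curvature operator (of the first kind) $\hat R$ acts on two-forms $\wedge^2\mathbb{R}^3$ by $\hat R(\omega)_{ij}=\frac12\sum_{k,l}R_{ijkl}\omega_{kl}$. The operator $\overline R$ acts on symmetric two-tensors $S^2(\mathbb{R}^3)$ by $\overline R(\varphi)_{ij}=\sum_{k,l}R_{iklj}\varphi_{kl}$. The curvature operator of the second kind is $\mathring R=\pi\circ\overline R: S^2_0(\mathbb{R}^3)\to S^2_0(\mathbb{R}^3)$, where $S^2_0(\mathbb{R}^3)$ is the 5-dimensional space of traceless symmetric two-tensors and $\pi:S^2(\mathbb{R}^3)\to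 S^2_0(\mathbb{R}^3)$ is the orthogonal projection. *)

(* Defs.v *)
From HB Require Import structures.
From mathcomp Require Import all_boot all_order all_algebra.
From mathcomp Require Import sesquilinear reals.

Set Implicit Arguments.
Unset Strict Implicit.
Unset Printing Implicit Defensive.

Import Order.TTheory GRing.Theory Num.Theory.
Local Open Scope ring_scope.

(* s lists the eigenvalues of f with algebraic multiplicity. The characteristic
   polynomial does not depend on the basis in which the matrix is taken. *)
Definition eigenvalues_are (F : fieldType) (vT : vectType F) (f : 'End(vT))
    (s : seq F) : Prop :=
  char_poly (passmx.mxof (vbasis {:vT}) (vbasis {:vT}) f) =
    \prod_(x <- s) ('X - x%:P).

(* Only meaningful when U is f-invariant: otherwise vsproj silently projects
   along an arbitrary complement of U. *)
Definition restr_lfun (F : fieldType) (vT : vectType F) (U : {vspace vT})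
    (f : 'End(vT)) : 'End(subvs_of U) :=
  linfun (vsproj U \o f \o vsval).

Lemma restr_lfunE (F : fieldType) (vT : vectType F) (U : {vspace vT})
    (f : 'End(vT)) (u : subvs_of U) :
  (f @: U <= U)%VS -> vsval (restr_lfun U f u) = f (vsval u).
Proof.
by move=> /subvP fU; rewrite lfunE /= vsprojK// fU// memv_img// subvsP.
Qed.

Section Frobenius.
Variables (R : realType) (n : nat).
Implicit Types (A B : 'M[R]_n) (U : {vspace 'M[R]_n}).

Definition frobenius A B : R := \sum_i \sum_j A i j * B i j.

Fact frobenius_is_bilinear : bilinear_for *%R (idfun \; *%R) frobenius.
Proof.
split=> [B a A A'|A a B B'] /=; rewrite /frobenius mulr_sumr -big_split /=;
  apply: eq_bigr => i _; rewrite mulr_sumr -big_split /=;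
  apply: eq_bigr => j _; rewrite !mxE.
- by rewrite mulrDl mulrA.
- by rewrite mulrDr mulrCA.
Qed.
HB.instance Definition _ := bilinear_isBilinear.Build R 'M[R]_n 'M[R]_n R
  *%R (idfun \; *%R) frobenius frobenius_is_bilinear.

Fact frobenius_sym A B : frobenius A B = (-1) ^+ false * idfun (frobenius B A).
Proof.
rewrite mul1r; apply: eq_bigr => i _; apply: eq_bigr => j _; exact: mulrC.
Qed.
HB.instance Definition _ := isHermitianSesquilinear.Build R 'M[R]_n
  false idfun frobenius frobenius_sym.

Fact frobenius_gt0 A : A != 0 -> 0 < frobenius A A.
Proof.
move=> A0; rewrite lt_neqAle eq_sym; apply/andP; split; last first.
  by apply: sumr_ge0 => i _; apply: sumr_ge0 => j _; rewrite -expr2 sqr_ge0.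
apply: contra_neq A0 => /psumr_eq0P A0; apply/matrixP => i j.
have /psumr_eq0P Ai0 : \sum_j A i j * A i j = 0.
  by apply: A0 => // k _; apply: sumr_ge0 => l _; rewrite -expr2 sqr_ge0.
have /eqP : A i j * A i j = 0 by apply: Ai0 => // l _; rewrite -expr2 sqr_ge0.
by rewrite mulf_eq0 orbb mxE => /eqP.
Qed.
HB.instance Definition _ := isDotProduct.Build R 'M[R]_n frobenius frobenius_gt0.

Definition orthproj U : 'End('M[R]_n) := daddv_pi U (orthov frobenius U).

Lemma capv_orthov U : (U :&: orthov frobenius U = 0)%VS.
Proof.
apply/eqP; rewrite -subv0; apply/subvP => A.
rewrite memv_cap memv0 => /andP[AU /mem_orthovP/(_ A AU) A0].
by apply: contraPT A0 => /frobenius_gt0 /lt0r_neq0/eqP.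
Qed.

Lemma addv_orthov U : (U + orthov frobenius U = fullv)%VS.
Proof.
apply/eqP; rewrite eqEdim subvf dimv_disjoint_sum ?capv_orthov//=.
pose f A := \row_(i < \dim U) frobenius A (vbasis U)`_i.
have f_lin : linear f.
  move=> a A B; apply/rowP => i; rewrite !mxE.
  by have /= := frobenius_is_bilinear.1 (vbasis U)`_i a A B.
pose Lf := GRing.isLinear.Build _ _ _ _ f f_lin.
pose F : {linear 'M[R]_n -> 'rV[R]_(\dim U)} := HB.pack f Lf.
have kerF : (lker (linfun F) <= orthov frobenius U)%VS.
  apply/subvP => A; rewrite memv_ker lfunE /= => /eqP fA0.
  apply/mem_orthovP => B /coord_vbasis ->; rewrite linear_sumr big1// => i _.
  rewrite linearZr_LR /=.
  by have /rowP/(_ i) := fA0; rewrite !mxE => ->; rewrite mulr0.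
rewrite -(limg_ker_dim (linfun F) fullv) capfv addnC leq_add//.
  by rewrite (leq_trans (dimvS (subvf _)))// dimvf /dim /= mul1n.
exact: dimvS.
Qed.

Lemma orthproj_mem U A : orthproj U A \in U.
Proof. exact: memv_pi. Qed.

Lemma orthproj_orthogonal U A B : B \in U -> frobenius (A - orthproj U A) B = 0.
Proof.
move=> BU; have AUV : A \in (U + orthov frobenius U)%VS.
  by rewrite addv_orthov memvf.
rewrite -{1}(daddv_pi_add (capv_orthov U) AUV) addrAC subrr add0r.
by have /mem_orthovP/(_ B BU) := memv_pi (orthov frobenius U) U A.
Qed.

End Frobenius.

Section SubspacesOfMatrices.
Variables (R : realType) (n : nat).
Implicit Types A : 'M[R]_n.

Definition two_forms : {vspace 'M[R]_n} :=
  lker (linfun (trmx \+ idfun : 'M[R]_n -> 'M[R]_n)).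

Definition sym_tensors : {vspace 'M[R]_n} :=
  lker (linfun (trmx \- idfun : 'M[R]_n -> 'M[R]_n)).

Definition traceless_sym_tensors : {vspace 'M[R]_n} :=
  (sym_tensors :&: lker (linfun (mxtrace : 'M[R]_n -> R^o)))%VS.

Lemma mem_two_forms A : (A \in two_forms) = (A^T == - A).
Proof. by rewrite memv_ker lfunE /= addr_eq0. Qed.

Lemma mem_sym_tensors A : (A \in sym_tensors) = (A^T == A).
Proof. by rewrite memv_ker lfunE /= subr_eq0. Qed.

Lemma mem_traceless_sym_tensors A :
  (A \in traceless_sym_tensors) = (A^T == A) && (\tr A == 0).
Proof. by rewrite memv_cap mem_sym_tensors memv_ker lfunE. Qed.

End SubspacesOfMatrices.

Section Curvature.
Variables (R : realType) (n : nat).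
Implicit Type Rm : 'I_n -> 'I_n -> 'I_n -> 'I_n -> R.

(* Rm i j k l is the component R_{ijkl} in the standard orthonormal basis of
   R^n; R_{ijij} is a sectional curvature. *)
Definition algebraic_curvature_operator Rm : Prop :=
  [/\ forall i j k l, Rm i j k l = - Rm j i k l,
      forall i j k l, Rm i j k l = - Rm i j l k,
      forall i j k l, Rm i j k l = Rm k l i j
    & forall i j k l, Rm i j k l + Rm i k l j + Rm i l j k = 0].

Definition curv_first_fun Rm (w : 'M[R]_n) : 'M[R]_n :=
  \matrix_(i, j) (2^-1 * \sum_k \sum_l Rm i j k l * w k l).

Definition curv_bar_fun Rm (phi : 'M[R]_n) : 'M[R]_n :=
  \matrix_(i, j) \sum_k \sum_l Rm i k l j * phi k l.

Fact curv_first_fun_is_linear Rm : linear (curv_first_fun Rm).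
Proof.
move=> a A B; apply/matrixP => i j; rewrite !mxE mulrCA -mulrDr; congr (_ * _).
rewrite mulr_sumr -big_split /=; apply: eq_bigr => k _.
rewrite mulr_sumr -big_split /=; apply: eq_bigr => l _.
by rewrite !mxE mulrDr mulrCA.
Qed.
HB.instance Definition _ Rm := GRing.isLinear.Build R 'M[R]_n 'M[R]_n _
  (curv_first_fun Rm) (curv_first_fun_is_linear Rm).

Fact curv_bar_fun_is_linear Rm : linear (curv_bar_fun Rm).
Proof.
move=> a A B; apply/matrixP => i j; rewrite !mxE.
rewrite mulr_sumr -big_split /=; apply: eq_bigr => k _.
rewrite mulr_sumr -big_split /=; apply: eq_bigr => l _.
by rewrite !mxE mulrDr mulrCA.
Qed.
HB.instance Definition _ Rm := GRing.isLinear.Build R 'M[R]_n 'M[R]_n _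
  (curv_bar_fun Rm) (curv_bar_fun_is_linear Rm).

Definition curvature_operator Rm : 'End(subvs_of (two_forms R n)) :=
  restr_lfun (two_forms R n) (linfun (curv_first_fun Rm)).

(* curv_bar_fun Rm maps symmetric tensors to symmetric tensors, on which
   orthproj is the orthogonal projection onto the traceless ones. *)
Definition curvature_operator_second_kind Rm :
    'End(subvs_of (traceless_sym_tensors R n)) :=
  restr_lfun (traceless_sym_tensors R n)
    (orthproj (traceless_sym_tensors R n) \o linfun (curv_bar_fun Rm))%VF.

Lemma curv_first_two_forms Rm : algebraic_curvature_operator Rm ->
  (linfun (curv_first_fun Rm) @: two_forms R n <= two_forms R n)%VS.
Proof.
case=> Rm1 _ _ _; apply/subvP => _ /memv_imgP[A _ ->].
rewrite lfunE /= mem_two_forms; apply/eqP/matrixP => i j.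
rewrite !mxE -mulrN -sumrN; congr (_ * _); apply: eq_bigr => k _.
by rewrite -sumrN; apply: eq_bigr => l _; rewrite Rm1 mulNr.
Qed.

Lemma curv_bar_sym_tensors Rm : algebraic_curvature_operator Rm ->
  (linfun (curv_bar_fun Rm) @: sym_tensors R n <= sym_tensors R n)%VS.
Proof.
case=> Rm1 Rm2 Rm3 _; apply/subvP => _ /memv_imgP[A + ->].
rewrite lfunE /= !mem_sym_tensors => /eqP/matrixP Asym.
apply/eqP/matrixP => i j; rewrite !mxE exchange_big /=.
apply: eq_bigr => k _; apply: eq_bigr => l _.
by rewrite -(Asym k l) mxE Rm3 Rm1 Rm2 opprK.
Qed.

Lemma curvature_operatorE Rm (w : subvs_of (two_forms R n)) :
  algebraic_curvature_operator Rm ->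
  vsval (curvature_operator Rm w) = curv_first_fun Rm (vsval w).
Proof. by move=> /curv_first_two_forms HR; rewrite restr_lfunE// lfunE. Qed.

Lemma curvature_operator_second_kindE Rm
    (phi : subvs_of (traceless_sym_tensors R n)) :
  vsval (curvature_operator_second_kind Rm phi) =
    orthproj (traceless_sym_tensors R n) (curv_bar_fun Rm (vsval phi)).
Proof.
rewrite restr_lfunE; first by rewrite comp_lfunE lfunE.
apply/subvP => _ /memv_imgP[A _ ->]; rewrite comp_lfunE; exact: orthproj_mem.
Qed.

End Curvature.

(* Main.v *)
Require Import Defs.
From HB Require Import structures.
From mathcomp Require Import all_boot all_order all_algebra.
From mathcomp Require Import boolp reals ring lra.

Import Order.TTheory GRing.Theory Num.Theory passmx.
Local Open Scope ring_scope.

(** In dimension three the Hodge star identifies two-forms with vectors, so an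
    algebraic curvature operator is the same thing as a symmetric 3 x 3 matrix
    S, through R_ijkl = sum_pq eps_ijp eps_klq S_pq ([curv_of_mx_surj]).

    Under this identification the curvature operator of the first kind is S
    itself ([curv_first_hodge]). Contracting the two Levi-Civita symbols turns
    the curvature operator of the second kind into
      phi |-> tr(S) phi - S phi - phi S + 2/3 tr(S phi) I
    on traceless symmetric phi ([second_kindE]).

    In an orthonormal eigenbasis e_i of S, with eigenvalues s_i, the
    off-diagonal tensors e_i e_j + e_j e_i are eigenvectors: the eigenvalue is
    tr(S) - s_i - s_j, the remaining eigenvalue of S. This accounts for a, b, c.
    The traceless diagonal tensors span an invariant plane on which the
    characteristic polynomial is
      (x - tr S / 3)^2 - 2/9 (3 tr(S^2) - (tr S)^2),
    whose roots are lambda_- and lambda_+.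

    The proof does not diagonalize S. Since both factors only involve the
    invariants of S, the resulting factorization of the characteristic
    polynomial of the second-kind operator is a polynomial identity in the six
    entries of S, and it is checked as such ([det_second_kind]) in coordinates
    on the five-dimensional space of traceless symmetric tensors. The
    eigenvalues a, b, c then enter only through tr S and tr(S^2), which the
    characteristic polynomial of S determines.

    The inequalities come down to (b + c - 2 a)^2 and (2 c - a - b)^2 being at
    most 2 ((a - b)^2 + (b - c)^2 + (c - a)^2) = 9 delta^2, where
    delta = (lambda_+ - lambda_-) / 2. *)

(** * Characteristic polynomials *)

(** Reduces identities between characteristic polynomials to the base field,
    where denominators can be cleared. *)
Lemma horner_inj (R : numDomainType) (p q : {poly R}) :
  (forall x, p.[x] = q.[x]) -> p = q.
Proof.
move=> pq; apply/eqP; rewrite -subr_eq0; apply/negP => /negP d0.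
pose s := [seq i%:R : R | i <- iota 0 (size (p - q))].
have := max_poly_roots d0 (rs := s); rewrite size_map size_iota ltnn.
have -> : all (root (p - q)) s.
  by apply/allP => x _; rewrite /root !hornerE pq subrr.
by rewrite map_inj_uniq ?iota_uniq => [/(_ isT isT)|m n /eqP/[!eqr_nat]/eqP].
Qed.

Lemma horner_char_poly (R : comNzRingType) (n : nat) (A : 'M[R]_n) (x : R) :
  (char_poly A).[x] = \det (x%:M - A).
Proof.
rewrite -[LHS]/(horner_eval x _) -det_map_mx; congr (\det _).
apply/matrixP => i j; rewrite !mxE [LHS]horner_evalE.
by rewrite hornerD hornerN hornerC hornerMn hornerX.
Qed.

(** The dimensions m and n are only propositionally equal in the application
    below, where m is the dimension of a subspace; hence the rectangular
    change of basis. *)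
Lemma char_poly_intertwine (F : fieldType) (m n : nat) (A : 'M[F]_m)
    (B : 'M[F]_n) (P : 'M[F]_(m, n)) :
  row_free P -> row_full P -> A *m P = P *m B -> char_poly A = char_poly B.
Proof.
move=> Pfree Pfull; have mn : m = n by rewrite -(eqP Pfree) (eqP Pfull).
case: n / mn in B P Pfree Pfull *; rewrite row_free_unit in Pfree => AP.
pose h := map_mx (@polyC F).
have : char_poly_mx A *m h _ _ P = h _ _ P *m char_poly_mx B.
  by rewrite mulmxBl mulmxBr -!map_mxM AP mul_scalar_mx mul_mx_scalar.
move/(congr1 determinant); rewrite !det_mulmx mulrC; apply: mulfI.
by rewrite det_map_mx polyC_eq0 -unitfE -unitmxE.
Qed.

(** A linear parametrization g of U with inverse k lets the characteristic
    polynomial of a restriction to U be read off from any matrix M that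
    describes f in the parameters. *)
Lemma char_poly_restr (F : fieldType) (V : vectType F) (U : {vspace V})
    (f : 'End(V)) (n : nat) (g : {linear 'rV[F]_n -> V}) (k : V -> 'rV[F]_n)
    (M : 'M[F]_n) :
  (forall v, g v \in U) -> cancel g k -> {in U, cancel k g} ->
  (forall v, f (g v) = g (v *m M)) ->
  char_poly (mxof (vbasis {: subvs_of U}) (vbasis {: subvs_of U})
    (restr_lfun U f)) = char_poly M.
Proof.
move=> gU gK kK fg; have eb := vbasisP {: subvs_of U}.
set e := vbasis _ in eb *.
have fU : (f @: U <= U)%VS.
  by apply/subvP => _ /memv_imgP[u uU ->]; rewrite -(kK u uU) fg gU.
pose Q := lin1_mx (rVof e \o vsproj U \o g).
have vQ v : v *m Q = rVof e (vsproj U (g v)) by rewrite /Q mul_rV_lin1.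
apply/esym/(@char_poly_intertwine _ _ _ _ _ Q).
- apply: inj_row_free => v; rewrite vQ => /eqP.
  rewrite rVof_eq0// => /eqP/(congr1 vsval).
  rewrite vsprojK ?gU// linear0 -[RHS](linear0 g).
  exact: (can_inj gK).
- apply/row_fullP; exists (\matrix_i k (vsval e`_i)).
  apply/row_matrixP => i; rewrite row_mul rowK vQ kK ?subvsP// vsvalK.
  by rewrite rVofE// row1.
- apply/row_matrixP => i; rewrite !row_mul vQ mul_mxof.
  rewrite 2![row i _]rowE vQ rVofK// -fg; congr (rVof e _).
  by apply/val_inj; rewrite /= restr_lfunE// !vsprojK ?fg ?gU.
Qed.

(** * Determinants of explicit matrices *)

Lemma alternating_sum (R : pzRingType) (m n : nat) (F : nat -> R) :
  \sum_(j <- iota m n) (-1) ^+ j * F j =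
    (-1) ^+ m * foldr (fun j acc => F j - acc) 0 (iota m n).
Proof.
elim: n m => [|n IHn] m; first by rewrite big_nil mulr0.
by rewrite big_cons IHn exprS mulN1r mulNr mulrBr.
Qed.

(** Laplace expansion along the first row. The alternating sum is a fold over
    natural numbers, without ordinals or signs, so that simplification expands
    the determinant of an explicit matrix into a polynomial in its entries. *)
Fixpoint laplace (R : nzRingType) (n : nat) (f : nat -> nat -> R) : R :=
  if n is n'.+1 then
    foldr (fun j acc =>
        f 0 j * laplace R n' (fun i k => f i.+1 (bump j k)) - acc)
      0 (iota 0 n)
  else 1.

Lemma det_laplace (R : comNzRingType) (n : nat) (f : nat -> nat -> R) :
  \det (\matrix_(i < n, j < n) f i j) = laplace R n f.
Proof.
elim: n f => [|n IHn] f; first by rewrite det_mx00.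
rewrite (expand_det_row _ ord0) [RHS]/laplace -/laplace.
set G := fun j : nat => f 0 j * laplace R n (fun i k => f i.+1 (bump j k)).
rewrite -[RHS]mul1r -[X in X * _](expr0 (-1)) -(alternating_sum _ _ _ G).
rewrite -[iota _ _]/(index_iota 0 n.+1) big_mkord; apply: eq_bigr => j _.
rewrite mxE /cofactor add0n mulrCA /G -IHn; congr (_ * (_ * \det _)).
by apply/matrixP => i k; rewrite !mxE.
Qed.

Definition mx_of_rows (R : nzRingType) (n : nat) (s : seq (seq R)) : 'M[R]_n :=
  \matrix_(i, j) (nth [::] s i)`_j.

Lemma det_sub_mx_of_rows (R : comNzRingType) (n : nat) (s : seq (seq R))
    (x : R) :
  \det (x%:M - mx_of_rows R n s) =
    laplace R n (fun i j => x *+ (i == j) - (nth [::] s i)`_j).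
Proof.
by rewrite -det_laplace; congr (\det _); apply/matrixP => i j; rewrite !mxE.
Qed.

(** * Orthogonal projections *)

Lemma orthproj_unique (R : realType) (n : nat) (U : {vspace 'M[R]_n})
    (A B : 'M[R]_n) :
  B \in U -> (forall C, C \in U -> frobenius (A - B) C = 0) ->
  orthproj U A = B.
Proof.
move=> BU AB; apply/eqP; rewrite -subr_eq0.
have DU : orthproj U A - B \in U by rewrite rpredB// orthproj_mem.
apply: contraT => /frobenius_gt0.
have -> : frobenius (orthproj U A - B) (orthproj U A - B) =
   frobenius (A - B) (orthproj U A - B) -
   frobenius (A - orthproj U A) (orthproj U A - B).
  rewrite -linearBl; congr (frobenius _ _).
  by rewrite opprB [RHS]addrC addrA subrK.
by rewrite AB// orthproj_orthogonal// subr0 ltxx.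
Qed.

Lemma frobenius_scalar_mx (R : realType) (n : nat) (k : R) (A : 'M[R]_n) :
  frobenius k%:M A = k * \tr A.
Proof.
rewrite /frobenius mulr_sumr; apply: eq_bigr => i _.
rewrite (bigD1 i)//= mxE eqxx mulr1n big1 ?addr0// => j ji.
by rewrite mxE eq_sym (negPf ji) mul0r.
Qed.

(** * The Hodge star in dimension three *)

Local Notation o3 k := (@Ordinal 3 k isT).
Local Notation o5 k := (@Ordinal 5 k isT).

Lemma big_ord3 (V : nmodType) (F : 'I_3 -> V) :
  \sum_i F i = F (o3 0) + F (o3 1) + F (o3 2).
Proof.
rewrite !big_ord_recl big_ord0 addr0 addrA.
by congr (F _ + F _ + F _); apply/val_inj.
Qed.

Lemma ordS3 : (ordS (o3 0) = o3 1) * (ordS (o3 1) = o3 2) *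
  (ordS (o3 2) = o3 0).
Proof. by do !split; apply/val_inj. Qed.

Lemma forall_ord3 (P : 'I_3 -> Prop) :
  P (o3 0) -> P (o3 1) -> P (o3 2) -> forall i, P i.
Proof.
by move=> P0 P1 P2 [[|[|[|//]]] i3]; rewrite (bool_irrelevance i3 isT).
Qed.

Lemma forall_ord5 (P : 'I_5 -> Prop) :
  P (o5 0) -> P (o5 1) -> P (o5 2) -> P (o5 3) -> P (o5 4) -> forall i, P i.
Proof.
move=> P0 P1 P2 P3 P4 [[|[|[|[|[|//]]]]] i5];
  by rewrite (bool_irrelevance i5 isT).
Qed.

Lemma big_ord5 (V : nmodType) (F : 'I_5 -> V) :
  \sum_i F i = F (o5 0) + F (o5 1) + F (o5 2) + F (o5 3) + F (o5 4).
Proof.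
rewrite !big_ord_recl big_ord0 addr0 !addrA.
by congr (F _ + F _ + F _ + F _ + F _); apply/val_inj.
Qed.

Section DimensionThree.
Variable R : realType.
Implicit Types (S phi : 'M[R]_3) (v : 'rV[R]_3).

(** The sign of the map (0, 1, 2) |-> (i, j, k), or zero if it is not injective,
    written as a quotient of
    Vandermonde determinants so that it evaluates by arithmetic alone. *)
Definition levi_civita (i j k : 'I_3) : R :=
  (j%:R - i%:R) * (k%:R - i%:R) * (k%:R - j%:R) / 2.

(** The Hodge star on components: the component along the k-th axis is the one
    on the plane of the two following axes in cyclic order. *)
Lemma antisymE (F : 'I_3 -> 'I_3 -> R) : (forall i j, F i j = - F j i) ->
  forall i j, F i j = \sum_k levi_civita i j k * F (ordS k) (ordS (ordS k)).
Proof.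
move=> F_anti.
have Fii i : F i i = 0 by have := F_anti i i; lra.
rewrite /levi_civita; apply: forall_ord3; apply: forall_ord3;
  rewrite big_ord3 !ordS3 /= ?Fii;
  rewrite ?(F_anti (o3 1) (o3 0)) ?(F_anti (o3 2) (o3 0));
  by rewrite ?(F_anti (o3 2) (o3 1)); field.
Qed.

Definition hodge v : 'M[R]_3 :=
  \matrix_(i, j) \sum_k levi_civita i j k * v 0 k.

Definition hodge_inv (A : 'M[R]_3) : 'rV[R]_3 :=
  \row_k A (ordS k) (ordS (ordS k)).

Fact hodge_is_linear : linear hodge.
Proof.
move=> x u v; apply/matrixP => i j; rewrite !mxE mulr_sumr -big_split /=.
by apply: eq_bigr => k _; rewrite !mxE mulrDr mulrCA.
Qed.
HB.instance Definition _ :=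
  GRing.isLinear.Build R 'rV[R]_3 'M[R]_3 _ hodge hodge_is_linear.

Lemma levi_civitaC i j k : levi_civita i j k = - levi_civita j i k.
Proof. by rewrite /levi_civita; field. Qed.

Lemma hodge_two_forms v : hodge v \in two_forms R 3.
Proof.
rewrite mem_two_forms; apply/eqP/matrixP => i j; rewrite !mxE -sumrN.
by apply: eq_bigr => k _; rewrite levi_civitaC mulNr.
Qed.

Lemma hodgeK : cancel hodge hodge_inv.
Proof.
move=> v; apply/rowP; apply: forall_ord3;
  by rewrite !mxE big_ord3 !ordS3 /levi_civita /=; field.
Qed.

Lemma hodge_invK : {in two_forms R 3, cancel hodge_inv hodge}.
Proof.
move=> A; rewrite mem_two_forms => /eqP/matrixP A_anti.
apply/matrixP => i j; rewrite mxE (antisymE (fun i j => A i j)).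
  by apply: eq_bigr => k _; rewrite mxE.
by move=> p q; have := A_anti q p; rewrite !mxE.
Qed.

(** * Curvature operators in dimension three *)

Definition curv_of_mx S (i j k l : 'I_3) : R :=
  \sum_p \sum_q levi_civita i j p * levi_civita k l q * S p q.

(** The Hodge star applied to each of the two antisymmetric pairs of indices;
    the pair symmetry of the tensor becomes the symmetry of S. *)
Lemma curv_of_mx_surj Rm : algebraic_curvature_operator Rm ->
  exists2 S, S^T = S & Rm = curv_of_mx S.
Proof.
case=> Rm1 Rm2 Rm3 _.
exists (\matrix_(p, q) Rm (ordS p) (ordS (ordS p)) (ordS q) (ordS (ordS q))).
  by apply/matrixP => p q; rewrite !mxE Rm3.
apply/funext => i; apply/funext => j; apply/funext => k; apply/funext => l.
rewrite (antisymE (fun i j => Rm i j k l)) => [|? ?]; last exact: Rm1.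
apply: eq_bigr => p _; set p1 := ordS p; set p2 := ordS p1.
rewrite (antisymE (Rm p1 p2)) => [|? ?]; last exact: Rm2.
by rewrite mulr_sumr; apply: eq_bigr => q _; rewrite mulrA mxE.
Qed.

Definition sym3 (a b c u w y : R) : 'M[R]_3 :=
  mx_of_rows R 3 [:: [:: a; u; w]; [:: u; b; y]; [:: w; y; c]].

Lemma sym3E S : S^T = S ->
  S = sym3 (S (o3 0) (o3 0)) (S (o3 1) (o3 1)) (S (o3 2) (o3 2))
           (S (o3 0) (o3 1)) (S (o3 0) (o3 2)) (S (o3 1) (o3 2)).
Proof.
move=> /matrixP S_sym; apply/matrixP; apply: forall_ord3; apply: forall_ord3;
  by rewrite [RHS]mxE //= -S_sym mxE.
Qed.

Lemma tr_sym3 a b c u w y : \tr (sym3 a b c u w y) = a + b + c.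
Proof. by rewrite /mxtrace big_ord3 !mxE. Qed.

Lemma trmx_sym3 a b c u w y : (sym3 a b c u w y)^T = sym3 a b c u w y.
Proof. by apply/matrixP; do 2![apply: forall_ord3]; rewrite !mxE. Qed.

(** The sum over k and l of eps_klq eps_klr is 2 delta_qr, which cancels the
    factor 1/2 in the curvature operator. *)
Lemma curv_first_hodge a b c u w y v :
  let S := sym3 a b c u w y in
  curv_first_fun (curv_of_mx S) (hodge v) = hodge (v *m S).
Proof.
apply/matrixP; apply: forall_ord3; apply: forall_ord3;
  rewrite [RHS]mxE [LHS]mxE !big_ord3 ![hodge _ _ _]mxE ![(_ *m _) _ _]mxE;
  rewrite !big_ord3 /curv_of_mx !big_ord3 !mxE /levi_civita /=; by field.
Qed.

(** With eps_ikp eps_jlq expanded as a determinant of Kronecker deltas, the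
    contraction against phi and S is a polarized adjugate; for traceless phi the
    terms containing tr(phi) drop out. *)
Lemma curv_bar_sym3 a b c u w y d e p q r :
  let S := sym3 a b c u w y in
  let phi := sym3 d e (- d - e) p q r in
  curv_bar_fun (curv_of_mx S) phi =
    (\tr (S *m phi))%:M + \tr S *: phi - S *m phi - phi *m S.
Proof.
apply/matrixP; apply: forall_ord3; apply: forall_ord3;
  rewrite !mxE /mxtrace !big_ord3 !mxE /curv_of_mx !big_ord3 !mxE;
  by rewrite /levi_civita /=; field.
Qed.

(** The projection only changes the multiple of the identity, which is
    orthogonal to all traceless tensors; 2/3 is the multiple that makes the
    right-hand side traceless. *)
Lemma second_kindE a b c u w y d e p q r :
  let S := sym3 a b c u w y in
  let phi := sym3 d e (- d - e) p q r in
  orthproj (traceless_sym_tensors R 3) (curv_bar_fun (curv_of_mx S) phi) =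
    (2 / 3 * \tr (S *m phi))%:M + \tr S *: phi - S *m phi - phi *m S.
Proof.
move=> S phi; have trphi : \tr phi = 0 by rewrite tr_sym3; ring.
have S_sym : S^T = S by exact: trmx_sym3.
have phi_sym : phi^T = phi by exact: trmx_sym3.
rewrite curv_bar_sym3 -/S -/phi.
clearbody S phi; set k := \tr (S *m phi).
apply: orthproj_unique => [|A].
  rewrite mem_traceless_sym_tensors 2!raddfB raddfD /= linearZ /=.
  rewrite 2!raddfB raddfD /= mxtraceZ mxtrace_scalar.
  rewrite tr_scalar_mx !trmx_mul S_sym phi_sym addrAC eqxx /= trphi.
  rewrite [\tr (phi *m S)]mxtrace_mulC -/k.
  by apply/eqP; field.
rewrite mem_traceless_sym_tensors => /andP[_ /eqP trA].
have -> : k%:M + \tr S *: phi - S *m phi - phi *m S -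
    ((2 / 3 * k)%:M + \tr S *: phi - S *m phi - phi *m S) = (k / 3)%:M.
  by apply/matrixP => i j; rewrite !mxE; case: (i == j); rewrite /=; field.
by rewrite frobenius_scalar_mx trA mulr0.
Qed.

(** * Coordinates on traceless symmetric tensors *)

Definition traceless_sym3 (v : 'rV[R]_5) : 'M[R]_3 :=
  sym3 (v 0 (o5 0)) (v 0 (o5 1)) (- v 0 (o5 0) - v 0 (o5 1))
       (v 0 (o5 2)) (v 0 (o5 3)) (v 0 (o5 4)).

Definition traceless_sym3_inv (A : 'M[R]_3) : 'rV[R]_5 :=
  \row_j [:: A (o3 0) (o3 0); A (o3 1) (o3 1); A (o3 0) (o3 1);
             A (o3 0) (o3 2); A (o3 1) (o3 2)]`_j.

Fact traceless_sym3_is_linear : linear traceless_sym3.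
Proof.
move=> x u v; apply/matrixP; apply: forall_ord3; apply: forall_ord3;
  by rewrite !mxE /=; ring.
Qed.
HB.instance Definition _ := GRing.isLinear.Build R 'rV[R]_5 'M[R]_3 _
  traceless_sym3 traceless_sym3_is_linear.

Lemma traceless_sym3_mem z : traceless_sym3 z \in traceless_sym_tensors R 3.
Proof.
rewrite mem_traceless_sym_tensors trmx_sym3 tr_sym3 eqxx /=.
by apply/eqP; ring.
Qed.

Lemma traceless_sym3K : cancel traceless_sym3 traceless_sym3_inv.
Proof. by move=> z; apply/rowP; apply: forall_ord5; rewrite !mxE. Qed.

Lemma traceless_sym3_invK :
  {in traceless_sym_tensors R 3, cancel traceless_sym3_inv traceless_sym3}.
Proof.
move=> A; rewrite mem_traceless_sym_tensors => /andP[/eqP A_sym /eqP trA].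
rewrite [RHS](sym3E _ A_sym) /traceless_sym3 !mxE /=; congr sym3.
by move: trA; rewrite /mxtrace big_ord3; lra.
Qed.

(** Matrix of phi |-> tr(S) phi - S phi - phi S + 2/3 tr(S phi) I acting on row
    vectors of coordinates (phi_00, phi_11, phi_01, phi_02, phi_12), for S with
    diagonal (a, b, c) and S_01 = u, S_02 = w, S_12 = y. *)
Definition second_kind_mx (a b c u w y : R) : 'M[R]_5 :=
  let t := a + b + c in
  mx_of_rows R 5
    [:: [:: t - 2 * a + 2 / 3 * (a - c); 2 / 3 * (a - c); - u; 0; y];
        [:: 2 / 3 * (b - c); t - 2 * b + 2 / 3 * (b - c); - u; w; 0];
        [:: - (2 / 3 * u); - (2 / 3 * u); c; - y; - w];
        [:: - (2 / 3 * w); 4 / 3 * w; - y; b; - u];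
        [:: 4 / 3 * y; - (2 / 3 * y); - w; - u; a]].

Lemma mulmx_sym3 a b c u w y d e f p q r :
  sym3 a b c u w y *m sym3 d e f p q r = mx_of_rows R 3
    [:: [:: a * d + u * p + w * q; a * p + u * e + w * r; a * q + u * r + w * f];
        [:: u * d + b * p + y * q; u * p + b * e + y * r; u * q + b * r + y * f];
        [:: w * d + y * p + c * q; w * p + y * e + c * r; w * q + y * r + c * f]].
Proof.
by apply/matrixP; do 2![apply: forall_ord3]; rewrite mxE big_ord3 !mxE.
Qed.

Lemma second_kind_mxE a b c u w y z :
  orthproj (traceless_sym_tensors R 3)
    (curv_bar_fun (curv_of_mx (sym3 a b c u w y)) (traceless_sym3 z)) =
  traceless_sym3 (z *m second_kind_mx a b c u w y).
Proof.
rewrite second_kindE !mulmx_sym3 tr_sym3.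
rewrite [\tr _]/mxtrace big_ord3 !mxE /=.
apply/matrixP; apply: forall_ord3; apply: forall_ord3;
  rewrite [RHS]mxE /= !mxE ?big_ord5 /= !mxE /=; by field.
Qed.

(** For diagonal S this is the splitting into off-diagonal tensors, which
    contribute the eigenvalues of S, and the plane of traceless diagonal
    tensors. Both factors are invariant under rotations (the last one involves
    tr(S^2) and tr S only), so the identity extends to all symmetric S. *)
Lemma det_second_kind a b c u w y x :
  \det (x%:M - second_kind_mx a b c u w y) =
  \det (x%:M - sym3 a b c u w y) *
    ((x - (a + b + c) / 3) ^+ 2 -
     2 / 9 * (3 * (a ^+ 2 + b ^+ 2 + c ^+ 2 +
                   2 * (u ^+ 2 + w ^+ 2 + y ^+ 2)) - (a + b + c) ^+ 2)).
Proof. by rewrite !det_sub_mx_of_rows /=; field. Qed.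

Lemma char_poly_curvature_operator a b c u w y
    (S := sym3 a b c u w y) :
  char_poly (mxof (vbasis {: subvs_of (two_forms R 3)})
      (vbasis {: subvs_of (two_forms R 3)})
      (curvature_operator (curv_of_mx S))) = char_poly S.
Proof.
apply: (@char_poly_restr _ _ _ _ _ (hodge : {linear _ -> _}) hodge_inv).
- exact: hodge_two_forms.
- exact: hodgeK.
- exact: hodge_invK.
- by move=> v; rewrite lfunE /= curv_first_hodge.
Qed.

Lemma char_poly_curvature_operator_second_kind a b c u w y
    (S := sym3 a b c u w y) :
  char_poly (mxof (vbasis {: subvs_of (traceless_sym_tensors R 3)})
      (vbasis {: subvs_of (traceless_sym_tensors R 3)})
      (curvature_operator_second_kind (curv_of_mx S))) =
  char_poly (second_kind_mx a b c u w y).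
Proof.
apply: (@char_poly_restr _ _ _ _ _ (traceless_sym3 : {linear _ -> _})
          traceless_sym3_inv).
- exact: traceless_sym3_mem.
- exact: traceless_sym3K.
- exact: traceless_sym3_invK.
- by move=> v; rewrite comp_lfunE lfunE /= second_kind_mxE.
Qed.

(** Three values of a monic cubic determine its elementary symmetric
    functions. *)
Lemma eigenvalues_sym3 a b c u w y l m n :
  (forall x, \det (x%:M - sym3 a b c u w y) = (x - l) * (x - m) * (x - n)) ->
  a + b + c = l + m + n /\
  a ^+ 2 + b ^+ 2 + c ^+ 2 + 2 * (u ^+ 2 + w ^+ 2 + y ^+ 2) =
    l ^+ 2 + m ^+ 2 + n ^+ 2.
Proof.
move=> detE; have := detE 0; have := detE 1; have := detE (-1).
rewrite !det_sub_mx_of_rows /= => EN E1 E0.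
have tE : a + b + c = l + m + n by lra.
split=> //; have sqE : (a + b + c) ^+ 2 = (l + m + n) ^+ 2 by rewrite tE.
by lra.
Qed.

End DimensionThree.

Theorem theorem1p1 (R : realType) (Rm : 'I_3 -> 'I_3 -> 'I_3 -> 'I_3 -> R)
    (a b c : R) :
  algebraic_curvature_operator Rm ->
  a <= b -> b <= c ->
  eigenvalues_are (curvature_operator Rm) [:: a; b; c] ->
  let delta := Num.sqrt 2 / 3 *
    Num.sqrt (3 * (a ^+ 2 + b ^+ 2 + c ^+ 2) - (a + b + c) ^+ 2) in
  let lambda_minus := (a + b + c) / 3 - delta in
  let lambda_plus := (a + b + c) / 3 + delta in
  eigenvalues_are (curvature_operator_second_kind Rm)
    [:: lambda_minus; a; b; c; lambda_plus] /\
  [/\ lambda_minus <= a, a <= b, b <= c & c <= lambda_plus].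
Proof.
move=> /curv_of_mx_surj[S /sym3E-> ->] ab bc.
move: (S _ _) (S _ _) (S _ _) (S _ _) (S _ _) (S _ _) => y w u r q p {S}.
move=> charS delta lambda_minus lambda_plus.
rewrite /eigenvalues_are char_poly_curvature_operator in charS.
have detS x : \det (x%:M - sym3 R p q r u w y) = (x - a) * (x - b) * (x - c).
  rewrite -horner_char_poly charS !big_cons big_nil mulr1.
  by rewrite !hornerE.
have [trS trSS] := eigenvalues_sym3 R p q r u w y a b c detS.
have delta2 :
    delta ^+ 2 = 2 / 9 * (3 * (a ^+ 2 + b ^+ 2 + c ^+ 2) - (a + b + c) ^+ 2).
  rewrite /delta !exprMn !sqr_sqrtr ?ler0n//; first by field.
  have := sqr_ge0 (a - b); have := sqr_ge0 (b - c); have := sqr_ge0 (a - c).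
  by nra.
have delta_ge0 : 0 <= delta by rewrite /delta !mulr_ge0 ?sqrtr_ge0 ?invr_ge0.
split.
  rewrite /eigenvalues_are char_poly_curvature_operator_second_kind.
  apply: horner_inj => x; rewrite horner_char_poly det_second_kind trS trSS.
  rewrite detS -delta2 !big_cons big_nil mulr1 !hornerE.
  by rewrite /lambda_minus /lambda_plus /=; ring.
split=> //.
  suff : (b + c - 2 * a) / 3 <= delta by rewrite /lambda_minus; lra.
  rewrite -(ler_pXn2r (n := 2)) ?nnegrE//; last by lra.
  by rewrite delta2; have := sqr_ge0 (b - c); nra.
suff : (2 * c - a - b) / 3 <= delta by rewrite /lambda_plus; lra.
rewrite -(ler_pXn2r (n := 2)) ?nnegrE//; last by lra.
by rewrite delta2; have := sqr_ge0 (a - b); nra.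
Qed.
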